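(* Let $H$ be a finite connected bridgeless simple graph, every vertex of which has degree two or three. Let $S$ be the set of degree-two vertices of $H$, and suppose $|S|=k\ge 2$. Then $H$ has a matching $M$ of size $$|M|=q:=\frac{|V(H)|-k+2}{2}$$ such that $H-M$ is the disjoint union of one tree containing all vertices of $S$ and zero or more cycles.
   Context: $H-M$ denotes the graph obtained from $H$ by deleting the edges in $M$ and keeping all vertices. ''Disjoint union'' means that the connected components of $H-M$ are exactly one tree (containing all of $S$) and zero or more cycles. Bridgeless means that no edge is a bridge (cut edge). *)

(* Defs.v *)
From mathcomp Require Import all_boot all_order all_algebra.

Set Implicit Arguments.
Unset Strict Implicit.
Unset Printing Implicit Defensive.

(* A finite simple graph is a symmetric irreflexive adjacency relation on a
   finType of vertices; an edge is the two-element set of its ends. *)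
Section Graphs.

Variable T : finType.
Implicit Types (e : rel T) (C : {set T}) (M F : {set {set T}}).

Definition simple_graph e : Prop := symmetric e /\ irreflexive e.

Definition degree e (x : T) : nat := #|[set y | e x y]|.

Definition edges e : {set {set T}} :=
  [set E : {set T} | [exists x, exists y, e x y && (E == [set x; y])]].

Definition del_edges e F : rel T := [rel x y | e x y && ([set x; y] \notin F)].

(* The vertex sets of the connected components, for a symmetric e. *)
Definition components e : {set {set T}} :=
  equivalence_partition (connect e) [set: T].

Definition induced e C : rel T := [rel x y | [&& x \in C, y \in C & e x y]].

Definition connected_in e C : Prop :=
  C != set0 /\ {in C &, forall x y, connect (induced e C) x y}.

Definition connected e : Prop := connected_in e [set: T].

Definition bridge e (E : {set T}) : Prop :=
  E \in edges e /\ #|components e| < #|components (del_edges e [set E])|.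

Definition bridgeless e : Prop := forall E : {set T}, ~ bridge e E.

Definition matching e M : Prop := M \subset edges e /\ trivIset M.

(* ucycle holds of sequences of size 0 and 2 that are not graph cycles, hence
   the explicit lower bound on the length. *)
Definition acyclic_in e C : Prop :=
  forall s : seq T, {subset s <= C} -> 2 < size s -> ~ ucycle e s.

Definition tree_on e C : Prop := connected_in e C /\ acyclic_in e C.

(* The whole subgraph induced on C is a cycle: s lists its vertices in cyclic
   order, and the only adjacencies are those between cyclic neighbours. *)
Definition cycle_on e C : Prop :=
  exists s : seq T,
    [/\ 2 < size s, uniq s, s =i C &
        {in C &, forall x y, e x y = (y == next s x) || (x == next s y)}].

Definition tree_and_cycles e (S : {set T}) : Prop :=
  exists C : {set T},
    [/\ C \in components e, tree_on e C, S \subset C &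
        forall D : {set T}, D \in components e -> D != C -> cycle_on e D].

End Graphs.

(* Main.v *)
Require Import Defs.
From mathcomp Require Import all_boot all_order all_algebra.
From mathcomp Require Import zify.

Set Implicit Arguments.
Unset Strict Implicit.
Unset Printing Implicit Defensive.

(** A suitable matching is built by growing the tree. Let [C] be a component of
    the graph that remains when a matching is deleted, and suppose that [C] is a
    tree and that every vertex of degree three outside [C] is matched. If [C]
    contains all vertices of degree two, then every other component is connected
    and 2-regular, hence a cycle, and counting degrees gives the size of the
    matching. If some vertex of degree two is still missing, it suffices to
    change the matching outside [C] so that a single matching edge between [C]
    and the outside is released while all vertices of degree three outside [C]
    stay matched ([growing_release]). Outside [C] the new remaining graph has
    maximum degree two, so what gets attached to [C] along the released edge is
    a path; by parity it ends in a leaf, and a leaf is a vertex of degree two of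
    the original graph. So [C] stays a tree and gains such a vertex.

    That the matching can be changed in this way is a statement about perfect
    matchings ([growing_step]). The tree and the partners of its vertices are
    contracted to one vertex [r], and the vertices of degree two are joined
    pairwise, which allows any number of them to remain unmatched. A perfect
    matching of this auxiliary graph then picks the edge to be released through
    the partner of [r]. It exists by the Berge-Tutte theorem, just as in the
    proof of Petersen's theorem: the components of a violating set [U] are
    mostly odd sets of vertices of degree three, which in a bridgeless graph are
    left by at least three edges, more than [U] can absorb
    ([contraction_matching]). The same lemma, with [r] a vertex of degree two,
    gives the first tree, a path ([growing_start]).

    The Berge-Tutte theorem itself is derived from Gallai's lemma
    ([separated_trans], [berge_tutte]), by exchanging single edges between two
    optimal matchings. *)

(** * Matchings as involutions *)

Section Involutions.
Variable T : finType.
Implicit Types (A W U : {set T}) (m n : {ffun T -> T}) (g : rel T).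

Lemma even_card_involution (f : T -> T) A :
  {in A, forall x, f x \in A} -> {in A, forall x, f (f x) = x} ->
  {in A, forall x, f x != x} -> ~~ odd #|A|.
Proof.
elim: {A}_.+1 {-2}A (ltnSn #|A|) => // k IH A leAk clA invA freeA.
have [-> | [x Ax]] := set_0Vmem A; first by rewrite cards0.
have fxA : f x \in A :\ x by rewrite !inE freeA //= clA.
rewrite (cardsD1 x) Ax (cardsD1 (f x)) fxA /= negbK.
have inj y : y \in A -> f y = x -> y = f x by move=> Ay <-; rewrite invA.
apply: IH.
- by move: leAk; rewrite (cardsD1 x) Ax (cardsD1 (f x) (A :\ x)) fxA; lia.
- move=> y; rewrite !inE => /and3P[yfx yx Ay]; rewrite clA // andbT.
  apply/andP; split; apply/eqP=> fE; last by rewrite (inj _ Ay fE) eqxx in yfx.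
  by rewrite -(invA _ Ay) fE invA ?eqxx in yx.
- by move=> y; rewrite !inE => /and3P[_ _]; apply: invA.
- by move=> y; rewrite !inE => /and3P[_ _]; apply: freeA.
Qed.

(** A matching is encoded as an involution moving each matched vertex to its
    partner and fixing the others: local changes are then case distinctions on
    equalities, and parity comes from fixed-point-free involutions. *)
Definition is_matching g m :=
  [forall x, m (m x) == x] && [forall x, (m x != x) ==> g x (m x)].

Lemma is_matchingP g m :
  reflect (involutive m /\ forall x, m x != x -> g x (m x)) (is_matching g m).
Proof.
apply: (iffP andP) => [[/forallP mK /forallP gm] | [mK gm]]; split.
- by move=> x; apply/eqP.
- by move=> x; apply/implyP.
- by apply/forallP=> x; rewrite mK.
- by apply/forallP=> x; apply/implyP/gm.
Qed.

Definition exposed m W := [set x in W | m x == x].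

Lemma odd_exposed g W m : is_matching (induced g W) m ->
  odd #|exposed m W| = odd #|W|.
Proof.
case/is_matchingP=> mK gm.
have -> : exposed m W = W :&: [set x | m x == x] by apply/setP=> x; rewrite !inE.
rewrite -(cardsID [set x | m x == x] W) oddD.
suff /negbTE-> : ~~ odd #|W :\: [set x | m x == x]| by rewrite addbF.
apply: (@even_card_involution m) => x; rewrite !inE => /andP[nx Wx] //.
rewrite mK eq_sym nx /=.
by have /and3P[] := gm _ nx.
Qed.

Definition unmatch m v : {ffun T -> T} :=
  [ffun x => if (x == v) || (x == m v) then x else m x].

Lemma unmatch_matching g m v : is_matching g m -> is_matching g (unmatch m v).
Proof.
case/is_matchingP=> mK gm; apply/is_matchingP; split=> x; rewrite !ffunE.
  have [E|/norP[xv xmv]] := boolP ((x == v) || (x == m v)); first by rewrite E.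
  by rewrite (inv_eq mK) (can_eq mK) (negbTE xv) (negbTE xmv) mK.
by case: ifP => _; [rewrite eqxx | apply: gm].
Qed.

(** The matching that gains the edge [x y] and loses the old edge at [y]; the
    vertex [x] is meant to be exposed beforehand. *)
Definition rematch m x y : {ffun T -> T} :=
  [ffun w => if w == x then y else if w == y then x else
             if w == m y then w else m w].

Lemma rematch_matching g m x y : symmetric g -> is_matching g m ->
  g x y -> x != y -> m x = x -> is_matching g (rematch m x y).
Proof.
move=> gsym /is_matchingP[mK gm] gxy xy mx.
have myx : m y != x by apply: contraNneq xy => E; rewrite -(mK y) E mx.
apply/is_matchingP; split=> w; rewrite !ffunE.
  have [->|wx] := eqVneq w x; first by rewrite eqxx eq_sym (negbTE xy).
  have [->|wy] := eqVneq w y; first by rewrite eqxx.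
  have [wz|wz] := eqVneq w (m y).
    by rewrite (negbTE wx) (negbTE wy) wz eqxx.
  have -> : (m w == x) = false.
    by apply: contra_neqF wx => /eqP E; rewrite -(mK w) E.
  have -> : (m w == y) = false.
    by apply: contra_neqF wz => /eqP <-; rewrite mK.
  have -> : (m w == m y) = false.
    by apply: contra_neqF wy => /eqP E; rewrite -(mK w) E mK.
  exact: mK.
have [->|wx] := eqVneq w x; first by [].
have [->|wy] := eqVneq w y; first by rewrite gsym.
have [->|wz] := eqVneq w (m y); first by rewrite eqxx.
exact: gm.
Qed.

Lemma exposed_rematch m x y W : involutive m -> x != y -> m x = x ->
  exposed (rematch m x y) W =
    exposed m W :\ x :\ y :|: (if m y == y then set0 else [set m y] :&: W).
Proof.
move=> mK xy mx.
have myx : m y != x by apply: contraNneq xy => E; rewrite -(mK y) E mx.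
have yx : (y == x) = false by rewrite eq_sym (negbTE xy).
apply/setP=> w; rewrite !inE !ffunE.
have [->|wx] := eqVneq w x.
  rewrite ?eqxx yx !andbF /=.
  by case: ifP => _; rewrite !inE // eq_sym (negbTE myx).
have [->|wy] := eqVneq w y.
  rewrite (negbTE xy) andbF /=.
  by case: eqVneq => E; rewrite !inE // eq_sym (negbTE E).
have [wz|wz] := eqVneq w (m y).
  rewrite -wz (negbTE wy) /= !inE wz mK eq_sym.
  by rewrite -wz !eqxx (negbTE wy) !andbF andbT.
by case: ifP => _; rewrite !inE ?(negbTE wz) orbF.
Qed.

End Involutions.

(** * The Berge-Tutte theorem *)

Section BergeTutte.
Variables (T : finType) (g : rel T).
Hypothesis gsym : symmetric g.
Implicit Types (A W U : {set T}) (m n : {ffun T -> T}).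

Let id_match W : is_matching (induced g W) [ffun x => x].
Proof. by apply/is_matchingP; split=> x; rewrite !ffunE ?eqxx. Qed.

Definition deficiency W : nat :=
  #|exposed [arg min_(m < [ffun x => x] | is_matching (induced g W) m)
                #|exposed m W|] W|.

Lemma deficiency_le W m : is_matching (induced g W) m ->
  deficiency W <= #|exposed m W|.
Proof. by rewrite /deficiency; case: arg_minnP => // n _ minn /minn. Qed.

Lemma deficiency_attained W :
  exists2 m, is_matching (induced g W) m & #|exposed m W| = deficiency W.
Proof. by rewrite /deficiency; case: arg_minnP => // n mn _; exists n. Qed.

Lemma induced_sym W : symmetric (induced g W).
Proof. by move=> x y; rewrite /induced /= gsym andbCA. Qed.

Lemma induced_sub W W' : W \subset W' -> subrel (induced g W) (induced g W').
Proof.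
by move=> /subsetP sWW' x y /and3P[Wx Wy gxy]; apply/and3P; split=> //; apply: sWW'.
Qed.

Lemma is_matching_sub (h h' : rel T) m : subrel h h' ->
  is_matching h m -> is_matching h' m.
Proof.
by move=> s /is_matchingP[mK hm]; apply/is_matchingP; split=> // x /hm /s.
Qed.

Lemma deficiencyD1 W v : deficiency (W :\ v) <= (deficiency W).+1.
Proof.
have [m mM <-] := deficiency_attained W.
have [mK gm] := is_matchingP _ _ (unmatch_matching v mM).
set m' := unmatch m v in mK gm.
have m'v : m' v = v by rewrite ffunE eqxx.
have m'M : is_matching (induced g (W :\ v)) m'.
  apply/is_matchingP; split=> // x nx.
  have /and3P[Wx Wmx gx] := gm x nx.
  rewrite /induced /= gx !in_setD1 Wx Wmx !andbT; apply/andP; split.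
    by apply: contraNneq nx => ->; rewrite m'v.
  by apply: contraNneq nx => E; rewrite -{2}(mK x) E m'v -E.
apply: leq_trans (deficiency_le m'M) _.
apply: leq_trans (_ : #|m v |: exposed m W| <= _).
  apply/subset_leq_card/subsetP=> x; rewrite !inE !ffunE.
  by case: (x == v) => //; case: (x == m v).
by rewrite cardsU1; case: (_ \notin _).
Qed.

Lemma deficiencyD W U : deficiency (W :\: U) <= deficiency W + #|U|.
Proof.
move: {2}#|U| (erefl #|U|) => k; elim: k U => [|k IH] U cU.
  by move/eqP: cU; rewrite cards_eq0 => /eqP->; rewrite setD0 leq_addr.
have /card_gt0P[u Uu] : 0 < #|U| by rewrite cU.
have cU' : #|U| = #|U :\ u|.+1 by rewrite (cardsD1 u) Uu.
have -> : W :\: U = (W :\: (U :\ u)) :\ u.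
  apply/setP=> x; rewrite !inE negb_and negbK.
  by case: (eqVneq x u) => [->|_]; rewrite ?Uu.
apply: leq_trans (deficiencyD1 _ _) _; rewrite cU' addnS ltnS; apply: IH.
by move: cU; rewrite cU' => -[].
Qed.

Definition optimal W m :=
  is_matching (induced g W) m && (#|exposed m W| == deficiency W).

Definition separated W u v := forall m, optimal W m -> m u = u -> m v = v -> u = v.

(** If both ends of an edge were exposed, adding that edge would beat the
    optimum. *)
Lemma separated_adjacent W u v : induced g W u v -> separated W u v.
Proof.
move=> guv m /andP[mM /eqP dm] mu mv; apply/eqP; apply: contraT => uv.
have := deficiency_le (rematch_matching (@induced_sym W) mM guv uv mu).
have [mK _] := is_matchingP _ _ mM.
rewrite exposed_rematch // mv eqxx setU0 -dm.
have /and3P[Wu Wv _] := guv.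
rewrite (cardsD1 u (exposed m W)) (cardsD1 v (exposed m W :\ u)).
by rewrite !inE Wu Wv mu mv !eqxx eq_sym uv /=; lia.
Qed.

(** The heart of Gallai's lemma. Suppose that [m] misses [u] and [v], and among
    the optimal matchings missing [t] let [n] agree with [m] on as many vertices
    as possible. Separation makes [n] cover [u] and [v], so by counting some
    [x <> t] is covered by [m] but missed by [n]. Giving [x] its [m]-partner in
    [n] yields another optimal matching missing [t] that agrees more with [m]. *)
Lemma separated_trans W u t v : u \in W -> v \in W -> t \in W ->
  (exists2 m, optimal W m & m t = t) ->
  separated W u t -> separated W t v -> separated W u v.
Proof.
move=> Wu Wv Wt [m0 opt0 m0t] sut stv m optm mu mv.
apply/eqP; apply: contraT => uv.
have mt : m t != t.
  by apply: contraNneq uv => mt; rewrite (sut m) // (stv m).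
pose agree n := #|[set w | m w == n w]|.
have P0 : optimal W m0 && (m0 t == t) by rewrite opt0 m0t eqxx.
case: (@arg_maxnP _ m0 (fun n => optimal W n && (n t == t)) agree P0).
move=> n /andP[optn /eqP nt] nmax.
have nu : n u != u.
  apply: contraNneq mt => nu; have := sut n optn nu nt.
  by move=> <-; rewrite mu.
have nv : n v != v.
  apply: contraNneq mt => nv; have := stv n optn nt nv.
  by move=> ->; rewrite mv.
have /andP[mM /eqP dm] := optm; have /andP[nM /eqP dn] := optn.
have [mK gm] := is_matchingP _ _ mM; have [nK gn] := is_matchingP _ _ nM.
have [x] : exists x, x \in (exposed n W :\: exposed m W) :\ t.
  apply/set0Pn; rewrite -card_gt0.
  have : [set u; v] \subset exposed m W :\: exposed n W.
    by apply/subsetP=> w; rewrite !inE => /orP[] /eqP->;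
       rewrite ?Wu ?Wv ?(negbTE nu) ?(negbTE nv) ?mu ?mv eqxx.
  move/subset_leq_card; rewrite cards2 uv.
  have := cardsID (exposed n W) (exposed m W).
  have := cardsID (exposed m W) (exposed n W).
  rewrite setIC dm dn (cardsD1 t (exposed n W :\: _)) => <- /addnI ->.
  by case: (t \in _) => /= [|/ltnW] //; rewrite ltnS.
rewrite !inE => /and3P[xt xm /andP[Wx /eqP nx]].
rewrite Wx /= in xm; have gxy := gm _ xm.
set y := m x in xm gxy; have xy : x != y by rewrite eq_sym.
have my : m y = x by rewrite /y mK.
have n'M := rematch_matching (@induced_sym W) nM gxy xy nx.
have := deficiency_le n'M; rewrite exposed_rematch //.
have /and3P[_ Wy _] := gxy.
have [ny|ny] := eqVneq (n y) y.
  rewrite setU0 -dn (cardsD1 x (exposed n W)) (cardsD1 y (exposed n W :\ x)).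
  by rewrite !inE Wx Wy nx ny !eqxx xm /= !add1n => /ltnW; rewrite ltnn.
have /and3P[_ Wny _] := gn _ ny.
move=> _.
have tx : t != x by rewrite eq_sym.
have ty : t != y by apply: contraNneq ny => <-; rewrite nt.
have nyx : n y != x by apply: contraNneq xy => E; rewrite -(nK y) E nx.
have n't : rematch n x y t = t.
  by rewrite ffunE (negbTE tx) (negbTE ty); case: ifP.
have optn' : optimal W (rematch n x y).
  rewrite /optimal n'M -dn exposed_rematch // (negbTE ny) /=.
  have -> : exposed n W :\ x :\ y = exposed n W :\ x.
    apply/setP=> w; rewrite !inE; case: eqVneq => // ->.
    by rewrite (negbTE ny) !andbF.
  rewrite (setIidPl _) ?sub1set // setUC cardsU1 (cardsD1 x (exposed n W)).
  by rewrite !inE nyx nx nK Wx eqxx (eq_sym y) (negbTE ny) Wny.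
have : agree (rematch n x y) <= agree n by apply: nmax; rewrite optn' n't eqxx.
rewrite leqNgt => /negP[]; apply: proper_card; apply/properP; split.
  apply/subsetP=> w; rewrite !inE !ffunE => /eqP mn.
  have [->|wx] := eqVneq w x; first by [].
  have [->|wy] := eqVneq w y; first by rewrite my.
  have [wz|wz] := eqVneq w (n y); last by rewrite mn.
  have mwy : m w = y by rewrite mn wz nK.
  by case/eqP: wx; rewrite -(mK w) mwy my.
exists x; rewrite !inE ?ffunE ?eqxx //.
by rewrite nx.
Qed.

(** The set [U] is chosen of maximal size among the sets whose removal raises the
    deficiency by at least their size. By maximality every remaining vertex is
    missed by some optimal matching of the rest, so by Gallai's lemma an optimal
    matching misses at most one vertex of each component; this bounds the number
    of components from below and shows that each of them is odd. The last
    clause, that every vertex of [U] is indispensable, serves to keep a chosen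
    vertex out of [U]. *)
Theorem berge_tutte W : exists U : {set T}, exists m : {ffun T -> T},
  [/\ is_matching (induced g W) m,
      forall C, C \in equivalence_partition (connect (induced g (W :\: U))) (W :\: U) ->
        odd #|C|,
      #|U| + #|exposed m W| <=
        #|equivalence_partition (connect (induced g (W :\: U))) (W :\: U)|,
      U \subset W &
      forall u n, u \in U -> is_matching (induced g (W :\ u)) n ->
        #|exposed m W| < #|exposed n (W :\ u)| ].
Proof.
pose good U := (U \subset W) && (deficiency W + #|U| <= deficiency (W :\: U)).
have good0 : good set0 by rewrite /good sub0set cards0 addn0 setD0 leqnn.
case: (arg_maxnP (fun U : {set T} => #|U|) good0) => U /andP[sUW dU] Umax.
have [m mM dm] := deficiency_attained W.
set W' := W :\: U in dU *.
have miss v : v \in W' -> exists2 m, optimal W' m & m v = v.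
  move=> W'v; have [n nM dn] := deficiency_attained (W' :\ v).
  have nM' : is_matching (induced g W') n.
    by apply: is_matching_sub nM; apply/induced_sub/subsetDl.
  have nv : n v = v.
    have [_ gn] := is_matchingP _ _ nM; apply/eqP; apply: contraT => /gn.
    by case/and3P; rewrite !inE eqxx.
  exists n => //; rewrite /optimal nM' /=; apply/eqP.
  have expE : #|exposed n W'| = (deficiency (W' :\ v)).+1.
    rewrite -dn (cardsD1 v) inE W'v nv eqxx add1n; congr _.+1.
    by apply: eq_card => x; rewrite !inE -!andbA.
  apply/eqP; rewrite eqn_leq deficiency_le // andbT expE leqNgt; apply/negP=> lt.
  have ne : deficiency (W' :\ v) <> deficiency W'.
    move=> E; have := odd_exposed nM'; have [m' m'M dm'] := deficiency_attained W'.
    by rewrite -(odd_exposed m'M) dm' expE E /=; case: odd.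
  have vU : v \notin U by move: W'v; rewrite inE => /andP[].
  suff : #|v |: U| <= #|U| by rewrite cardsU1 vU add1n ltnn.
  apply: Umax; rewrite /good subUset sub1set sUW andbT; apply/andP; split.
    by move: W'v; rewrite inE => /andP[].
  rewrite cardsU1 vU setUC -setDDl -/W'.
  have lt' : deficiency W' < deficiency (W' :\ v).
    by rewrite ltn_neqAle -ltnS lt andbT eq_sym; apply/eqP.
  by rewrite add1n addnS; apply: leq_ltn_trans dU lt'.
have csym : connect_sym (induced g W') by apply/sym_connect_sym/induced_sym.
have sep u v : u \in W' -> connect (induced g W') u v -> separated W' u v.
  move=> W'u /connectP[p]; elim: p u W'u => [|t p IH] u W'u /=.
    by move=> _ -> n _ _ _.
  case/andP=> gut pth lastv; have /and3P[_ W't _] := gut.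
  apply: (@separated_trans W' u t v) => //; last 1 first.
  - exact: IH.
  - have : v \in t :: p by rewrite lastv mem_last.
    move: pth W't; clear -g; elim: p t => [|z p IHp] t /=.
      by move=> _ W't; rewrite mem_seq1 => /eqP->.
    case/andP=> /and3P[_ W'z _] pth W't; rewrite in_cons => /orP[/eqP-> //|].
    exact: IHp.
  - exact: miss.
  - exact: separated_adjacent.
exists U, m; split=> //.
- move=> C /imsetP[v W'v ->]; rewrite -/W' in W'v *.
  set C' := [set _ in _ | _].
  have inC' x : (x \in C') = (x \in W') && connect (induced g W') v x.
    by rewrite !inE.
  have [n optn nv] := miss v W'v; have /andP[nM _] := optn.
  have [nK gn] := is_matchingP _ _ nM.
  have C'v : v \in C' by rewrite inC' W'v connect0.
  have free x : x \in C' :\ v -> n x != x.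
    case/setD1P=> xv; rewrite inC' => /andP[W'x cvx].
    apply: contraNneq xv => nx; apply/eqP.
    by apply: (sep x v _ _ n) => //; rewrite csym.
  rewrite (cardsD1 v) C'v add1n /=.
  apply: (@even_card_involution _ n) => // x C'x.
  have gx := gn _ (free x C'x); have /and3P[_ W'nx _] := gx.
  move: C'x => /setD1P[xv]; rewrite inC' => /andP[W'x cvx].
  apply/setD1P; split; last by rewrite inC' W'nx (connect_trans cvx (connect1 gx)).
  by apply: contraNneq xv => E; rewrite -(nK x) E nv.
- rewrite dm addnC; apply: leq_trans dU _.
  have [n nM dn] := deficiency_attained W'.
  pose cls v := [set y in W' | connect (induced g W') v y].
  rewrite -dn -(@card_in_imset _ _ cls); last first.
    move=> u v /setIdP[W'u /eqP nu] /setIdP[W'v /eqP nv] E.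
    apply: (sep u v _ _ n) => //; last by rewrite /optimal nM dn eqxx.
    have : v \in cls v by apply/setIdP.
    by rewrite -E => /setIdP[].
  apply/subset_leq_card/subsetP=> C /imsetP[x].
  by case/setIdP=> W'x _ ->; apply: imset_f.
- move=> u n Uu nM; rewrite dm.
  have := deficiencyD (W :\ u) (U :\ u); have := deficiency_le nM.
  have -> : (W :\ u) :\: (U :\ u) = W'.
    by apply/setP=> x; rewrite !inE; case: eqVneq => [->|] //; rewrite Uu.
  by have := dU; rewrite (cardsD1 u U) Uu; lia.
Qed.
End BergeTutte.

(** * Arcs, cuts and degree sums *)

Section Arcs.
Variable T : finType.
Implicit Types (A B C : {set T}) (f : rel T).

Definition arcs f A B : {set T * T} :=
  [set p | [&& p.1 \in A, p.2 \in B & f p.1 p.2]].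

Lemma in_arcs f A B x y :
  ((x, y) \in arcs f A B) = [&& x \in A, y \in B & f x y].
Proof. by rewrite inE. Qed.

Lemma card_arcs f A B : #|arcs f A B| = \sum_(x in A) #|[set y in B | f x y]|.
Proof.
rewrite -sum1_card; under [RHS]eq_bigr do rewrite -sum1_card.
rewrite pair_big_dep /=; apply: eq_bigl => p; rewrite !inE.
by case: (_ \in A).
Qed.

Lemma card_arcs_sym f A B : symmetric f -> #|arcs f A B| = #|arcs f B A|.
Proof.
move=> fsym; have swapK : involutive (fun p : T * T => (p.2, p.1)) by case.
rewrite -(card_imset _ (inv_inj swapK)); apply: eq_card => p.
apply/imsetP/idP => [[q] | Ap].
  by rewrite inE => /and3P[Aq Bq fq] ->; rewrite inE /= Aq Bq fsym.
exists (p.2, p.1); last by rewrite swapK.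
by move: Ap; rewrite !inE /= fsym => /and3P[-> -> ->].
Qed.

(** Reversal pairs off the arcs within [A]. *)
Lemma even_arcs f A : symmetric f -> irreflexive f -> ~~ odd #|arcs f A A|.
Proof.
move=> fsym firr.
apply: (@even_card_involution _ (fun p : T * T => (p.2, p.1))) => -[x y] //=.
  by rewrite !inE /= fsym => /and3P[-> -> ->].
rewrite inE /= xpair_eqE => /and3P[_ _ fxy]; apply/nandP; left.
by apply: contraTneq fxy => ->; rewrite firr.
Qed.

Lemma sum_degree f A :
  \sum_(x in A) degree f x = #|arcs f A A| + #|arcs f A (~: A)|.
Proof.
rewrite !card_arcs -big_split /=; apply: eq_bigr => x _.
rewrite /degree -(cardsID A); congr (_ + _); apply: eq_card => y.
  by rewrite !inE andbC.
by rewrite !inE.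
Qed.

Lemma connect_escape f A x y : connect f x y -> x \in A -> y \notin A ->
  exists u v, [/\ u \in A, v \notin A & f u v].
Proof.
case/connectP=> p; elim: p x => [|z p IH] x /=; first by move=> _ -> ->.
case/andP=> fxz pth lasty Ax nAy.
by case: (boolP (z \in A)) => Az; [apply: IH Az nAy | exists x, z].
Qed.

(** A connected graph on [n] vertices has at least [n - 1] edges, each of which
    gives two arcs: a largest subset of [A] containing [x0] and satisfying the
    bound could otherwise absorb a neighbouring vertex. *)
Lemma connected_card f A x0 : symmetric f -> x0 \in A ->
  {in A, forall y, connect (induced f A) x0 y} ->
  2 * #|A| <= #|arcs f A A| + 2.
Proof.
move=> fsym Ax0 conA.
pose good B := [&& x0 \in B, B \subset A & 2 * #|B| <= #|arcs f B B| + 2].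
have good0 : good [set x0].
  by rewrite /good set11 sub1set Ax0 cards1 muln1 leq_addl.
case: (arg_maxnP (fun B : {set T} => #|B|) good0) => B /and3P[Bx0 sBA leB] Bmax.
have [->|nBA] := eqVneq A B; first by [].
have /subsetPn[y Ay nBy] : ~~ (A \subset B).
  by apply: contra nBA => sAB; rewrite eqEsubset sAB.
have [u [v [Bu nBv /and3P[_ Av fuv]]]] := connect_escape (conA _ Ay) Bx0 nBy.
suff : #|v |: B| <= #|B| by rewrite cardsU1 nBv add1n ltnn.
apply: Bmax; rewrite /good !inE Bx0 orbT subUset sub1set Av sBA /= cardsU1 nBv.
have uv : u != v by apply: contraNneq nBv => <-.
have sub : (u, v) |: ((v, u) |: arcs f B B) \subset arcs f (v |: B) (v |: B).
  apply/subsetP=> p; rewrite !inE => /or3P[/eqP->|/eqP->|/and3P[-> -> ->]] /=.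
  - by rewrite Bu eqxx fuv orbT.
  - by rewrite Bu eqxx fsym fuv orbT.
  - by rewrite !orbT.
have := subset_leq_card sub.
rewrite !cardsU1 !inE /= (negbTE nBv) xpair_eqE (negbTE uv) !andbF /=.
move=> leAB; rewrite mulnDr muln1 addnC leq_add2r.
by apply: leq_trans leB _; rewrite addn2.
Qed.

(** If only one edge left [A], deleting it would disconnect its ends. *)
Lemma cut_ge2 f A : symmetric f -> connected f -> bridgeless f ->
  A != set0 -> A != setT -> 1 < #|arcs f A (~: A)|.
Proof.
move=> fsym [_ conf] nobridge /set0Pn[a Aa].
rewrite -subTset => /subsetPn[b _ nAb].
have conn x y : connect f x y.
  apply: (connect_sub _ (conf x y (in_setT x) (in_setT y))) => u v.
  by case/and3P=> _ _ /connect1.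
have [x [y [Ax nAy fxy]]] := connect_escape (conn a b) Aa nAb.
have arcxy : (x, y) \in arcs f A (~: A) by rewrite !inE /= Ax nAy.
rewrite ltnNge; apply/negP=> le1.
have /eqP/cards1P[p arcsE] : #|arcs f A (~: A)| = 1.
  by apply/eqP; rewrite eqn_leq le1; apply/card_gt0P; exists (x, y).
move: arcxy; rewrite arcsE => /set1P defp.
apply: (nobridge [set x; y]); split.
  by rewrite inE; apply/existsP; exists x; apply/existsP; exists y; rewrite fxy eqxx.
set d := del_edges f _.
have nconxy : ~~ connect d x y.
  apply/negP=> /connect_escape/(_ Ax nAy)[u [v [Au nAv /andP[fuv /= uvE]]]].
  have : (u, v) \in arcs f A (~: A) by rewrite !inE /= Au nAv.
  rewrite arcsE -defp => /set1P[ux vy].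
  by rewrite ux vy set11 in uvE.
apply: leq_ltn_trans (_ : 1 < _).
  rewrite -(cards1 [set: T]); apply/subset_leq_card/subsetP=> C /imsetP[z _ ->].
  by rewrite inE; apply/eqP/setP=> w; rewrite !inE conn.
pose cls z := [set w in [set: T] | connect d z w].
have ncls : cls x != cls y.
  apply: contraNneq nconxy => E.
  have : y \in cls y by rewrite !inE connect0.
  by rewrite -E !inE.
rewrite -[1.+1]/(true.+1) -ncls -cards2; apply/subset_leq_card/subsetP=> C.
by rewrite !inE => /orP[] /eqP->; apply: imset_f.
Qed.

Lemma odd_cut f A : symmetric f -> irreflexive f -> odd #|A| ->
  {in A, forall x, degree f x = 3} -> odd #|arcs f A (~: A)|.
Proof.
move=> fsym firr oddA deg3; have := sum_degree f A.
rewrite (eq_bigr _ deg3) sum_nat_const => /(congr1 odd).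
by rewrite oddM oddD oddA (negbTE (even_arcs A fsym firr)).
Qed.

End Arcs.

(** * Recognizing trees and cycles *)

Section TreesAndCycles.
Variables (T : finType) (f : rel T).
Hypotheses (fsym : symmetric f) (firr : irreflexive f).
Implicit Types (A B C D : {set T}).

(** With only [n - 1] edges there can be no cycle, since deleting an edge of a
    cycle keeps the graph connected and would contradict the lower bound on the
    number of edges. *)
Lemma tree_of_card C x0 : x0 \in C ->
  {in C &, forall x y, connect (induced f C) x y} ->
  #|arcs f C C| + 2 = 2 * #|C| -> tree_on f C.
Proof.
move=> Cx0 conC cardC; split; first by split=> //; apply/set0Pn; exists x0.
move=> s sC; case: s sC => [|x [|y q]] // sC /=; rewrite !ltnS => q0.
rewrite /ucycle => /andP[/= /andP[fxy pyx] /and3P[]].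
rewrite inE negb_or => /andP[xy nqx] nqy uq.
have Cx : x \in C by apply: sC; rewrite mem_head.
have Cy : y \in C by apply: sC; rewrite !inE eqxx orbT.
pose f' := [rel u v | f u v && ([set u; v] != [set x; y])].
have f'sym : symmetric f' by move=> u v /=; rewrite fsym setUC.
have neq_edge u v z : z \in [set u; v] -> z \notin [set x; y] ->
  [set u; v] != [set x; y].
  by move=> uvz nxyz; apply: contraNneq nxyz => <-.
have f'yx : connect (induced f' C) y x.
  apply/connectP; exists (rcons q x); last by rewrite last_rcons.
  have {sC}: {subset y :: q <= C}.
    by move=> z qz; apply: sC; rewrite inE qz orbT.
  move: pyx nqx nqy uq q0 => pyx nqx nqy uq q0 sC.
  rewrite rcons_path in pyx; rewrite rcons_path; case/andP: pyx => pyq flast.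
  have lastC : last y q \in q.
    by case: (q) q0 => // z q' _; rewrite /= mem_last.
  apply/andP; split; last first.
    rewrite /induced /= Cx flast sC ?inE ?lastC ?orbT //=.
    apply: (neq_edge _ _ (last y q)); first by rewrite !inE eqxx.
    rewrite !inE negb_or.
    by apply/andP; split; [apply: contraNneq nqx | apply: contraNneq nqy] => <-.
  case: (q) pyq sC nqx nqy => //= z q' /andP[fyz pzq] sC.
  rewrite !inE !negb_or => /andP[xz nq'x] /andP[yz nq'y].
  apply/andP; split.
    rewrite /induced /= Cy fyz sC ?inE ?eqxx ?orbT //=.
    by apply: (neq_edge _ _ z); rewrite !inE ?eqxx ?orbT // negb_or eq_sym xz eq_sym.
  have {}sC : {subset z :: q' <= C} by move=> w wq; apply: sC; rewrite inE wq orbT.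
  have nx : x \notin z :: q' by rewrite inE negb_or xz.
  have ny : y \notin z :: q' by rewrite inE negb_or yz.
  elim: q' z pzq sC nx ny {fyz xz yz nq'x nq'y} => //= w r IH z /andP[fzw pr] sC nx ny.
  apply/andP; split; last first.
    apply: IH => // [v wv||]; first by apply: sC; rewrite inE wv orbT.
      by move: nx; rewrite inE negb_or => /andP[].
    by move: ny; rewrite inE negb_or => /andP[].
  rewrite /induced /= fzw !sC ?inE ?eqxx ?orbT //=.
  apply: (neq_edge _ _ z); rewrite !inE ?eqxx // negb_or.
  by move: nx ny; rewrite !inE !negb_or !(eq_sym z) => /andP[-> _] /andP[-> _].
have f'symC : connect_sym (induced f' C) by apply/sym_connect_sym/induced_sym.
have con' : {in C, forall z, connect (induced f' C) x0 z}.
  move=> z Cz; apply: (connect_sub _ (conC _ _ Cx0 Cz)) => u v /and3P[Cu Cv fuv].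
  have [E|nE] := eqVneq [set u; v] [set x; y]; last first.
    by apply: connect1; rewrite /induced /= Cu Cv fuv nE.
  have : (u \in [set x; y]) && (v \in [set x; y]) by rewrite -E !inE !eqxx orbT.
  have uv : u != v by apply: contraTneq fuv => ->; rewrite firr.
  rewrite !inE => /andP[] /orP[] /eqP uE /orP[] /eqP vE;
    rewrite uE vE ?eqxx // in uv *.
  by rewrite f'symC.
have := connected_card f'sym Cx0 con'; rewrite -cardC leq_add2r => leC.
have sub : (x, y) |: ((y, x) |: arcs f' C C) \subset arcs f C C.
  apply/subsetP=> p; rewrite !inE => /or3P[/eqP->|/eqP->|/and3P[-> -> /andP[->]]] //=.
  - by rewrite Cx Cy fxy.
  - by rewrite Cx Cy fsym fxy.
have := subset_leq_card sub.
rewrite !cardsU1 !inE /= eqxx (setUC [set y] [set x]) eqxx !andbF /=.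
rewrite xpair_eqE (negbTE xy) /=.
by rewrite !add1n => /leq_trans/(_ leC)/ltnW; rewrite ltnn.
Qed.

(** A path is prolonged at its head [x], away from its second vertex [y], until
    the new neighbour lies on the path and closes a cycle. *)
Lemma cycle_exists D x0 : x0 \in D -> {in D, forall x y, f x y -> y \in D} ->
  {in D, forall x, 1 < degree f x} ->
  exists2 s : seq T, ucycle f s & 2 < size s /\ {subset s <= D}.
Proof.
move=> Dx0 clD degD.
have other x y : x \in D -> exists2 v, f x v & v != y.
  move=> Dx; have := degD x Dx; rewrite /degree (cardsD1 y).
  set n := #|_ :\ y| => lt1; have : 0 < n by move: lt1; case: (_ \in _); lia.
  by case/card_gt0P=> v; rewrite !inE => /andP[vy fxv]; exists v.
suff grow : forall k x y q, #|T| - size q <= k -> path f x (y :: q) ->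
    uniq [:: x, y & q] -> {subset [:: x, y & q] <= D} ->
    exists2 s : seq T, ucycle f s & 2 < size s /\ {subset s <= D}.
  have [y fxy xy] := other x0 x0 Dx0.
  apply: (grow _ x0 y [::] (leqnn _)); rewrite /= ?fxy ?inE ?(eq_sym x0) ?xy //.
  by move=> z; rewrite !inE => /orP[] /eqP-> //; apply: clD fxy.
elim=> [|k IH] x y q leqk pth uxyq sD.
all: have szq : (size q).+2 <= #|T|
  by rewrite -[_.+2]/(size [:: x, y & q]) -(card_uniqP uxyq) max_card.
  by move: leqk szq; clear; lia.
have Dx : x \in D by apply: sD; rewrite mem_head.
have [v fxv vy] := other x y Dx.
have vx : v != x by apply: contraTneq fxv => ->; rewrite firr.
have [vq|nvq] := boolP (v \in q).
  case/splitPr: vq pth uxyq sD => q1 q2 pth uxyq sD.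
  have eqs : [:: x, y & q1 ++ v :: q2] = [:: x, y & rcons q1 v] ++ q2.
    by rewrite /= cat_rcons.
  exists [:: x, y & rcons q1 v]; last first.
    split; first by rewrite /= size_rcons.
    by move=> z sz; apply: sD; rewrite eqs mem_cat sz.
  rewrite /ucycle; move: uxyq; rewrite eqs cat_uniq => /andP[-> _].
  rewrite andbT /= -cats1 -cats1 -catA /=.
  move: pth; rewrite /= !cat_path /= => /and3P[-> -> /andP[-> _]].
  by rewrite fsym fxv.
apply: (IH v x (y :: q)).
- by move: leqk szq; rewrite /=; clear; lia.
- by rewrite /= fsym fxv.
- by rewrite cons_uniq uxyq !inE !negb_or vx vy nvq.
- by move=> z; rewrite inE => /orP[/eqP->|/sD//]; apply: clD fxv.
Qed.

(** In a 2-regular graph the neighbours of a vertex of a cycle are the two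
    distinct cyclic ones, so any cycle is closed under adjacency and fills the
    component. *)
Lemma cycle_of_degree2 D x0 : x0 \in D -> {in D, forall x y, f x y -> y \in D} ->
  {in D, forall x, connect f x0 x} ->
  {in D, forall x, degree f x = 2} -> cycle_on f D.
Proof.
move=> Dx0 clD conD degD.
have [s cycs [size_s sD]] : exists2 s : seq T, ucycle f s & 2 < size s /\ {subset s <= D}.
  by apply: (cycle_exists Dx0 clD) => x /degD->.
have /andP[cs us] := cycs.
have next_neq_prev x : x \in s -> next s x != prev s x.
  move=> sx; apply/eqP=> E.
  have [i s' defs] := rot_to sx.
  have size_s' : 2 < size (x :: s') by rewrite -defs size_rot.
  have us' : uniq (x :: s') by rewrite -defs rot_uniq.
  have E2 : next (x :: s') (next (x :: s') x) = x.
    by rewrite -defs !next_rot // E next_prev.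
  case: s' us' size_s' E2 {defs} => [|y [|z q]] //= /and3P[].
  rewrite !inE !negb_or => /and3P[xy xz _] _ _ _.
  by rewrite eqxx (eq_sym y) (negbTE xy) eqxx => zx; rewrite zx eqxx in xz.
have adj x y : x \in s -> f x y = (y == next s x) || (y == prev s x).
  move=> sx; have Dx := sD _ sx.
  have sub : [set next s x; prev s x] \subset [set y | f x y].
    apply/subsetP=> z; rewrite !inE => /orP[] /eqP->.
      exact: next_cycle cs sx.
    by rewrite fsym; apply: prev_cycle cs sx.
  have /eqP/setP/(_ y) : [set next s x; prev s x] == [set y | f x y].
    by rewrite eqEcard sub cards2 next_neq_prev // -/(degree f x) degD.
  by rewrite !inE.
have sE : s =i D.
  move=> x; apply/idP/idP => [/sD // | Dx]; apply: contraT => nsx.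
  have [z sz] : exists z, z \in s.
    by case: (s) size_s => // z ? _; exists z; rewrite mem_head.
  have fcs : connect_sym f by apply: sym_connect_sym.
  have czx : connect f z x.
    by apply: (connect_trans _ (conD _ Dx)); rewrite fcs conD // sD.
  have [|| u [v []]] := @connect_escape _ f [set w in s] z x czx; rewrite ?inE //.
  move=> su nsv; rewrite adj // => /orP[] /eqP E; case/negP: nsv; rewrite E.
    by rewrite mem_next.
  by rewrite mem_prev.
exists s; split=> // x y; rewrite -!sE => sx sy; rewrite adj //.
congr (_ || _); apply/eqP/eqP => ->.
  by rewrite next_prev.
by rewrite prev_next.
Qed.

End TreesAndCycles.

(** * Perfect matchings after a contraction *)

Section Contraction.
Variables (T : finType) (e : rel T).
Hypotheses (esym : symmetric e) (eirr : irreflexive e).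
Hypotheses (econ : connected e) (ebridge : bridgeless e).
Hypothesis edeg : forall x, degree e x = 2 \/ degree e x = 3.
Variables (Q : {set T}) (r s0 : T).
Hypotheses (Qr : r \in Q) (nQs0 : s0 \notin Q) (deg_s0 : degree e s0 = 2).
Implicit Types (A C U : {set T}).

Definition contract x := if x \in Q then r else x.

(** The graph obtained by contracting [Q] to its representative [r] and then
    making the degree-two vertices outside [Q] pairwise adjacent. The extra
    edges stand for the freedom to leave such vertices exposed. *)
Definition contracted : rel T := [rel x y | (x != y) &&
  ([&& x \notin Q, degree e x == 2, y \notin Q & degree e y == 2] ||
   [exists u, exists v, [&& contract u == x, contract v == y & e u v]])].

(** The vertices of the contracted graph, from which one degree-two vertex is
    dropped if that is needed to make their number even. *)
Definition kept : {set T} :=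
  if odd #|r |: ~: Q| then (r |: ~: Q) :\ s0 else r |: ~: Q.

Lemma contracted_sym : symmetric contracted.
Proof.
move=> x y; rewrite /contracted /= eq_sym; congr (_ && (_ || _)).
  by rewrite andbA [RHS]andbA andbC.
apply/existsP/existsP => -[u /existsP[v /and3P[ux vy euv]]];
  by exists v; apply/existsP; exists u; rewrite ux vy esym.
Qed.

Lemma even_kept : ~~ odd #|kept|.
Proof.
rewrite /kept; case: ifP => [|/negbT//].
by rewrite (cardsD1 s0) !inE nQs0 orbT /=.
Qed.

Lemma kept_contract x : x != s0 -> contract x \in kept.
Proof.
have rs0 : r != s0 by apply: contraNneq nQs0 => <-.
rewrite /contract /kept => xs0.
by case: ifP => Qx; case: ifP => _; rewrite !inE ?Qx ?rs0 ?xs0 ?eqxx ?orbT.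
Qed.

Lemma contract_kept x : x \in kept -> contract x = x.
Proof.
rewrite /contract => Wx; case: ifP => // Qx; apply/eqP; rewrite eq_sym.
by move: Wx; rewrite /kept; case: ifP => _; rewrite !inE Qx ?orbF // => /andP[].
Qed.

(** If no such matching existed, Berge-Tutte and parity would give a set [U] whose removal leaves at least
    [#|U| + 2] odd components. Apart from at most two of them, namely the one
    containing [r] and the one containing degree-two vertices (the extra edges
    put these into a single component), a component consists of vertices of
    degree three and is left by an odd number of edges of [e], hence by at least
    three; the exceptional ones are still left by at least two, as [e] has no
    bridge. All these edges end in [U] or in the dropped vertex [s0], which
    absorb at most [3 * #|U| + 2] of them: too few. The count needs [r] outside
    [U] or [Q] a single vertex of degree at most three. A matching that misses
    at most two vertices other than [r] ensures the former, because the vertices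
    of [U] are indispensable. *)
Lemma contraction_matching :
  Q = [set r] \/ (exists2 n, is_matching (induced contracted (kept :\ r)) n &
                             #|exposed n (kept :\ r)| <= 2) ->
  exists2 p, is_matching (induced contracted kept) p &
             {in kept, forall x, p x != x}.
Proof.
move=> HQ.
have [U [m [mM oddP leP sUW essU]]] := berge_tutte contracted_sym kept.
have evd : ~~ odd #|exposed m kept| by rewrite (odd_exposed mM) even_kept.
have [d0|dpos] := posnP #|exposed m kept|.
  exists m => // x Wx; apply/negP=> mx.
  by have := card0_eq d0 x; rewrite !inE Wx mx.
have {evd dpos} d2 : 2 <= #|exposed m kept|.
  by rewrite ltn_neqAle dpos andbT; apply: contraNneq evd => <-.
have Qr1 : r \in U -> Q = [set r].
  case: HQ => // -[n nM len] Ur; have := essU r n Ur nM.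
  by move=> /leq_trans/(_ len); rewrite ltnNge d2.
set W' := kept :\: U in oddP leP; set R := connect _ in oddP leP.
set P := equivalence_partition R W' in oddP leP.
have Rsym : connect_sym (induced contracted W').
  by apply/sym_connect_sym/induced_sym/contracted_sym.
have eqR : {in W' & &, equivalence_rel R}.
  move=> x y z _ _ _; split=> [|Rxy]; [apply: connect0 |].
  exact: (same_connect Rsym Rxy).
have /and3P[/eqP covP tiP _] : partition P W' by apply: equivalence_partitionP.
have closedP C x y : C \in P -> x \in C -> y \in W' -> R x y -> y \in C.
  case/imsetP=> z _ -> /setIdP[_ Rzx] W'y Rxy; apply/setIdP; split=> //.
  exact: connect_trans Rzx Rxy.
have sCW C x : C \in P -> x \in C -> x \in W'.
  by move=> PC Cx; rewrite -covP; apply/bigcupP; exists C.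
have keptC C x : C \in P -> x \in C -> x \in kept.
  by move=> PC /(sCW _ _ PC)/setDP[].
have eqP_mem C C' x : C \in P -> C' \in P -> x \in C -> x \in C' -> C = C'.
  by move=> PC PC' Cx C'x; rewrite -(def_pblock tiP PC Cx) (def_pblock tiP PC' C'x).
(* L C is the set of original vertices represented in C, and K consists of those
   represented in no component. *)
pose L C := [set x | contract x \in C].
pose K := [set x | contract x \notin W'].
have inL C x : (x \in L C) = (contract x \in C) by rewrite in_set.
have inCK x : (x \in ~: K) = (contract x \in W') by rewrite in_setC in_set negbK.
have cutK C : C \in P -> arcs e (L C) (~: L C) \subset arcs e (L C) K.
  move=> PC; apply/subsetP=> -[x y]; rewrite !in_arcs in_setC !inL.
  case/and3P=> Cx nCy exy; rewrite Cx exy andbT in_set /=.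
  apply: contra nCy => W'y.
  have [->//|nxy] := eqVneq (contract y) (contract x).
  apply: (closedP _ _ _ PC Cx W'y); apply: connect1.
  rewrite /induced /= W'y (sCW _ _ PC Cx) /contracted /= eq_sym nxy /=.
  apply/orP; right; apply/existsP; exists x; apply/existsP; exists y.
  by rewrite !eqxx.
have sumcut : \sum_(C in P) #|arcs e (L C) K| = #|arcs e (~: K) K|.
  rewrite card_arcs (partition_big (fun x => pblock P (contract x)) [in P]) /=.
    apply: eq_bigr => C PC; rewrite card_arcs; apply: eq_bigl => x.
    rewrite inL inCK; apply/idP/andP => [Cx | [W'x /eqP <-]].
      by rewrite (sCW _ _ PC Cx) (def_pblock tiP PC Cx).
    by rewrite mem_pblock covP.
  by move=> x; rewrite inCK -covP; apply: pblock_mem.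
have KsU : K \subset s0 |: U.
  apply/subsetP=> x; rewrite in_set => nW'.
  have [->|xs0] := eqVneq x s0; first exact: setU11.
  apply: setU1r; move: nW'; rewrite in_setD (kept_contract xs0) andbT negbK.
  rewrite /contract; case: ifP => // Qx Ur.
  by move: Qx; rewrite (Qr1 Ur) => /set1P->.
have leK : #|arcs e (~: K) K| <= 3 * #|U| + 2.
  rewrite (card_arcs_sym _ _ esym) card_arcs.
  apply: leq_trans (_ : \sum_(x in K) degree e x <= _).
    apply: leq_sum => x _; apply: subset_leq_card.
    by apply/subsetP=> y /setIdP[_ exy]; rewrite inE.
  apply: leq_trans (_ : \sum_(x in s0 |: U) degree e x <= _).
    rewrite [X in _ <= X](big_setID K) /= (setIidPr KsU).
    exact: leq_addr.
  have leU : \sum_(x in U) degree e x <= 3 * #|U|.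
    rewrite mulnC -sum_nat_const; apply: leq_sum => x _.
    by case: (edeg x) => ->.
  have [Us0|nUs0] := boolP (s0 \in U).
    by rewrite (setUidPr _) ?sub1set // (leq_trans leU) ?leq_addr.
  by rewrite big_setU1 //= deg_s0 addnC leq_add2r.
pose nS C := [exists x in C, (x \notin Q) && (degree e x == 2)].
have leC C : C \in P -> 3 <= #|arcs e (L C) K| + (r \in C) + nS C.
  move=> PC.
  have leLK := subset_leq_card (cutK C PC).
  have [c Cc] : exists c, c \in C.
    case/set_0Vmem: (C) => [C0|[c Cc]]; last by exists c.
    by have := oddP _ PC; rewrite C0 cards0.
  have cut2 : 1 < #|arcs e (L C) (~: L C)|.
    apply: cut_ge2 => //.
      by apply/set0Pn; exists c; rewrite inE (contract_kept (keptC _ _ PC Cc)).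
    have [C' PC' neC] : exists2 C', C' \in P & C' != C.
      have : 0 < #|P :\ C|.
        by move: leP d2; rewrite (cardsD1 C P) PC; clear; lia.
      by case/card_gt0P=> C' /setD1P[neC PC']; exists C'.
    have [c' C'c'] : exists c', c' \in C'.
      case/set_0Vmem: (C') => [C0|[c' C'c']]; last by exists c'.
      by have := oddP _ PC'; rewrite C0 cards0.
    apply/negP=> /eqP/setP/(_ c').
    rewrite !inE (contract_kept (keptC _ _ PC' C'c')) => Cc'.
    by rewrite (eqP_mem C' C c' PC' PC C'c' Cc') eqxx in neC.
  have [Cr|nCr] := boolP (r \in C).
    by rewrite addn1 (leq_trans _ (leq_addr _ _)) // ltnS (leq_trans cut2).
  have [SC|nSC] := boolP (nS C); first by rewrite addn0 addn1 ltnS (leq_trans cut2).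
  rewrite !addn0; apply: leq_trans leLK; rewrite ltn_neqAle cut2 andbT.
  have LC : L C = C.
    apply/setP=> x; rewrite inE /contract; case: ifP => // Qx.
    rewrite (negbTE nCr); symmetry; apply/negP=> Cx.
    have := contract_kept (keptC _ _ PC Cx); rewrite /contract Qx => rx.
    by rewrite rx Cx in nCr.
  apply/eqP=> E; have : odd #|arcs e (L C) (~: L C)|; last by rewrite -E.
  rewrite LC; apply: odd_cut => // [|x Cx]; first exact: oddP.
  case: (edeg x) => // d2x; case/negP: nSC; apply/existsP; exists x.
  rewrite Cx d2x eqxx andbT /=; apply: contraNN nCr => Qx.
  by have := contract_kept (keptC _ _ PC Cx); rewrite /contract Qx => ->.
have one_r : \sum_(C in P) (r \in C) <= 1.
  rewrite -big_mkcondr /= sum1dep_card; apply/card_le1_eqP=> C C'.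
  rewrite !inE => /andP[PC Cr] /andP[PC' C'r].
  by symmetry; apply: (eqP_mem _ _ r PC PC').
have one_S : \sum_(C in P) nS C <= 1.
  rewrite -big_mkcondr /= sum1dep_card; apply/card_le1_eqP=> C C'.
  rewrite !inE => /andP[PC /existsP[x /and3P[Cx nQx d2x]]].
  case/andP=> PC' /existsP[x' /and3P[C'x' nQx' d2x']].
  symmetry; have [xx'|nxx'] := eqVneq x x'.
    by apply: (eqP_mem _ _ x PC PC' Cx); rewrite xx'.
  apply: (eqP_mem _ _ x' PC PC' _ C'x').
  apply: (closedP _ _ _ PC Cx (sCW _ _ PC' C'x')); apply: connect1.
  rewrite /induced /contracted /= (sCW _ _ PC Cx) (sCW _ _ PC' C'x') nxx'.
  by rewrite nQx d2x nQx' d2x'.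
(* 3(|U| + 2) <= 3|P| <= (3|U| + 2) + 1 + 1 is absurd *)
have : 3 * #|P| <= \sum_(C in P) (#|arcs e (L C) K| + (r \in C) + nS C).
  by rewrite mulnC -sum_nat_const; apply: leq_sum.
rewrite !big_split /= sumcut => /leq_trans.
move/(_ _ (leq_add (leq_add leK one_r) one_S)).
move: leP d2; rewrite -/P; move: #|P| #|U| #|exposed _ _| => p u d; clear; lia.
Qed.

End Contraction.

(** * Growing the tree *)

Section Growth.
Variables (T : finType) (e : rel T).
Hypotheses (esym : symmetric e) (eirr : irreflexive e).
Hypotheses (econ : connected e) (ebridge : bridgeless e).
Hypothesis edeg : forall x, degree e x = 2 \/ degree e x = 3.
Implicit Types (A C D : {set T}) (m n : {ffun T -> T}).

Definition matching_edges m : {set {set T}} :=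
  [set [set x; m x] | x in [set x | m x != x]].

Definition residual m : rel T := del_edges e (matching_edges m).

Lemma mem_matching_edges m x y : involutive m -> x != y ->
  ([set x; y] \in matching_edges m) = (y == m x).
Proof.
move=> mK xy; apply/imsetP/eqP => [[z _ E] | yE]; last first.
  by exists x; rewrite ?yE // inE eq_sym -yE.
have : (x \in [set z; m z]) && (y \in [set z; m z]) by rewrite -E !inE !eqxx orbT.
rewrite !inE => /andP[] /orP[] /eqP xE /orP[] /eqP yE; move: xy;
  by rewrite xE yE ?mK ?eqxx.
Qed.

Lemma residualE m x y : is_matching e m -> residual m x y = e x y && (y != m x).
Proof.
move=> /is_matchingP[mK _]; rewrite /residual /del_edges /=.
case exy: (e x y) => //=; rewrite mem_matching_edges //.
by apply: contraTneq exy => ->; rewrite eirr.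
Qed.

Lemma residual_sym m : symmetric (residual m).
Proof. by move=> x y; rewrite /residual /del_edges /= esym setUC. Qed.

Lemma residual_irr m : irreflexive (residual m).
Proof. by move=> x; rewrite /residual /del_edges /= eirr. Qed.

Lemma degree_residual m x : is_matching e m ->
  degree (residual m) x + (m x != x) = degree e x.
Proof.
move=> mM; have [_ em] := is_matchingP _ _ mM.
rewrite /degree (cardsD1 (m x) [set y | e x y]) addnC inE; congr (_ + _).
  have [->|/em->//] := eqVneq (m x) x; by rewrite eirr.
by apply: eq_card => y; rewrite !inE residualE // andbC.
Qed.

(** A stage of the construction: [C] is a component of the residual graph with
    [#|C| - 1] edges, that is, a tree, and the matching covers every vertex of
    degree three outside [C], so that the residual graph has maximum degree two
    there. Nothing prevents components other than [C] from being paths. *)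
Definition growing m C : Prop :=
  [/\ is_matching e m /\ C != set0,
      {in C &, forall x y, connect (induced (residual m) C) x y},
      {in C, forall x y, residual m x y -> y \in C},
      forall x, x \notin C -> degree e x = 3 -> m x != x
    & #|arcs (residual m) C C| + 2 = 2 * #|C|].

Lemma sum_degree_closed (f : rel T) C : {in C, forall x y, f x y -> y \in C} ->
  \sum_(x in C) degree f x = #|arcs f C C|.
Proof.
move=> clC; rewrite sum_degree [X in _ + X]eq_card0 ?addn0 // => -[x y].
rewrite in_arcs in_setC; apply/negP=> /and3P[Cx nCy fxy].
by rewrite (clC x Cx y fxy) in nCy.
Qed.

Lemma connect_induced (f : rel T) C x y :
  {in C, forall x y, f x y -> y \in C} -> x \in C -> connect f x y ->
  connect (induced f C) x y.
Proof.
move=> clC Cx /connectP[p]; elim: p x Cx => [|z p IH] x Cx /=.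
  by move=> _ ->; apply: connect0.
case/andP=> fxz pth lasty; have Cz := clC x Cx z fxz.
apply: connect_trans (IH z Cz pth lasty); apply: connect1.
by rewrite /induced /= Cx Cz.
Qed.

(** Only an upper bound on the degree sum has to be checked: connectedness gives
    at least [2 * #|C| - 2], and the degree sum is even. *)
Lemma component_growing m c0 (C := [set x | connect (residual m) c0 x]) :
  is_matching e m -> (forall x, x \notin C -> degree e x = 3 -> m x != x) ->
  \sum_(x in C) degree (residual m) x < 2 * #|C| -> growing m C.
Proof.
move=> mM cov sumC.
have fsym := residual_sym m.
have clC : {in C, forall x y, residual m x y -> y \in C}.
  move=> x Cx y fxy; move: Cx; rewrite !inE => /connect_trans; apply.
  exact: connect1.
have Cc0 : c0 \in C by rewrite inE.
have conC : {in C, forall y, connect (induced (residual m) C) c0 y}.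
  by move=> y Cy; apply: connect_induced => //; move: Cy; rewrite inE.
have fcs : connect_sym (induced (residual m) C).
  exact/sym_connect_sym/induced_sym.
split=> //.
- by split=> //; apply/set0Pn; exists c0.
- move=> x y Cx Cy; apply: (connect_trans (y := c0)); last exact: conC.
  by rewrite fcs conC.
have := connected_card fsym Cc0 conC.
have := even_arcs C fsym (residual_irr m).
move: sumC; rewrite sum_degree_closed //.
by move: #|arcs _ _ _| #|C| => a c; clear; lia.
Qed.

Lemma degree_residual_le2 m x : is_matching e m ->
  (degree e x = 3 -> m x != x) -> degree (residual m) x <= 2.
Proof.
move=> mM cov; have := degree_residual x mM.
case: (edeg x) => dx; rewrite dx; first by move <-; apply: leq_addr.
by rewrite cov // addn1 => -[->].
Qed.

Lemma degree_residual3 m x : is_matching e m ->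
  degree e x = 3 -> m x != x -> degree (residual m) x = 2.
Proof. by move=> mM dx nx; have := degree_residual x mM; rewrite dx nx addn1 => -[]. Qed.

(** Contracting the single vertex [s1] yields a matching that covers [s1] and all
    vertices of degree three. The residual graph then has maximum degree two and
    [s1] as a leaf, so the component of [s1] is a path. *)
Lemma growing_start s1 s0 : s1 != s0 -> degree e s1 = 2 -> degree e s0 = 2 ->
  exists m C, growing m C.
Proof.
move=> s10 d1 d0.
have nQs0 : s0 \notin [set s1] by rewrite inE eq_sym.
have [p pM freep] :=
  contraction_matching esym eirr econ ebridge edeg (set11 s1) nQs0 d0 (or_introl erefl).
have [pK gp] := is_matchingP _ _ pM.
have cE x : contract [set s1] s1 x = x.
  by rewrite /contract; case: ifP => // /set1P->.
pose m : {ffun T -> T} := [ffun x => if e x (p x) then p x else x].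
have mM : is_matching e m.
  apply/is_matchingP; split=> x; rewrite !ffunE.
    have [exp|/negbTE exp] := boolP (e x (p x)); last by rewrite exp.
    by rewrite pK esym exp.
  by case: ifP => // _; rewrite eqxx.
have covered x : x != s0 -> x == s1 \/ degree e x = 3 -> m x != x.
  move=> xs0 hx.
  have Wx : x \in kept [set s1] s1 s0.
    by have := kept_contract (set11 s1) nQs0 xs0; rewrite cE.
  have nx := freep _ Wx; have /and3P[_ _ /andP[_ ]] := gp _ nx.
  case/orP=> [/and4P[] | ].
    by rewrite inE => nxs1 /eqP d2x; case: hx; rewrite ?(negbTE nxs1) // d2x.
  case/existsP=> u /existsP[v /and3P[]]; rewrite !cE => /eqP-> /eqP-> exp.
  by rewrite ffunE exp.
exists m, [set x | connect (residual m) s1 x]; apply: component_growing => //.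
  by move=> x _ d3; apply: covered; [apply: contra_eq_neq d3 => ->; rewrite d0 | right].
set C := [set _ | _].
have Cs1 : s1 \in C by rewrite inE.
have sumC' : \sum_(x in C :\ s1) degree (residual m) x <= 2 * #|C :\ s1|.
  rewrite mulnC -sum_nat_const; apply: leq_sum => x _.
  apply: degree_residual_le2 => // d3; apply: covered; last by right.
  by apply: contra_eq_neq d3 => ->; rewrite d0.
rewrite (big_setD1 s1) //= (cardsD1 s1 C) Cs1.
have : degree (residual m) s1 = 1.
  have := degree_residual s1 mM; rewrite covered ?d1 //; last by left.
  by rewrite addn1 => -[].
by move: sumC' => /[swap] ->; clear; lia.
Qed.

(** Releasing a matching edge [w (m w)] that leaves the tree raises the degree sum
    on [C] by one, and outside [C] degrees are at most two, so the degree sum of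
    the enlarged component still is below twice its size. It is even, hence the
    new part contains a vertex of degree one, which has degree two in [e]. *)
Lemma growing_release m C m' w : growing m C -> is_matching e m' ->
  w \in C -> m w \notin C -> m' w = w ->
  {in C, forall x, x != w -> m' x = m x} ->
  (forall x, x \notin C -> degree e x = 3 -> m' x != x) ->
  exists2 C', growing m' C' &
    C :&: [set x | degree e x == 2] \proper C' :&: [set x | degree e x == 2].
Proof.
move=> [[mM _] conC clC _ cardC] m'M Cw nCb m'w m'C cov'.
have [mK em] := is_matchingP _ _ mM.
pose C' := [set x | connect (residual m') w x].
have wb : m w != w by apply: contraNneq nCb => ->.
have sCC' : C \subset C'.
  apply/subsetP=> x Cx; rewrite inE.
  apply: (connect_sub _ (conC _ _ Cw Cx)) => u v /and3P[Cu Cv].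
  rewrite residualE // => /andP[euv nv]; apply: connect1; rewrite residualE // euv /=.
  have [uw|uw] := eqVneq u w; last by rewrite m'C.
  by rewrite uw m'w; apply: contraTneq euv => ->; rewrite uw eirr.
have C'b : m w \in C'.
  by rewrite inE connect1 // residualE // em //= m'w.
have sumC : \sum_(x in C) degree (residual m') x = (2 * #|C|).-1.
  have E x : x \in C -> degree (residual m') x = degree (residual m) x + (x == w).
    move=> Cx; have := degree_residual x mM; have := degree_residual x m'M.
    have [->|xw] := eqVneq x w; last by rewrite m'C // => <- /addIn->; rewrite addn0.
    by rewrite m'w eqxx wb addn0 => -> <-.
  rewrite (eq_bigr _ E) big_split /= sum_degree_closed //.
  rewrite -big_mkcondr (big_pred1 w) => [|x]; last first.
    by rewrite /= andbC; case: eqVneq => // ->.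
  by rewrite -cardC; clear; lia.
have sumC' : \sum_(x in C') degree (residual m') x =
    (2 * #|C|).-1 + \sum_(x in C' :\: C) degree (residual m') x.
  by rewrite (big_setID C) /= (setIidPr sCC') sumC.
have cardC' : #|C'| = #|C| + #|C' :\: C|.
  by rewrite -(cardsID C C') (setIidPr sCC').
have Cpos : 0 < #|C| by apply/card_gt0P; exists w.
have gC' : growing m' C'.
  apply: component_growing => //.
    by move=> x nC'x; apply: cov'; apply: contra nC'x; apply: (subsetP sCC').
  have : \sum_(x in C' :\: C) degree (residual m') x <= 2 * #|C' :\: C|.
    rewrite mulnC -sum_nat_const; apply: leq_sum => x /setDP[_ nCx].
    exact: degree_residual_le2 (cov' x nCx).
  rewrite -/C' sumC' cardC'; move: Cpos.
  by move: (\sum_(_ in _) _) #|C| #|C' :\: C| => a b c; clear; lia.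
exists C' => //; rewrite properE setSI //=; apply/negP=> /subsetP sS.
have sum2 : \sum_(x in C' :\: C) degree (residual m') x = 2 * #|C' :\: C|.
  rewrite mulnC -sum_nat_const; apply: eq_bigr => x /setDP[C'x nCx].
  case: (edeg x) => dx; last exact: degree_residual3 (cov' x nCx dx).
  have : x \in C :&: [set x | degree e x == 2] by apply: sS; apply/setIP; rewrite inE dx.
  by case/setIP=> Cx; rewrite Cx in nCx.
have [_ _ clC' _ cardC2] := gC'.
move: sumC'; rewrite sum_degree_closed // sum2; move: Cpos cardC2; rewrite cardC'.
by move: #|arcs _ _ _| #|C| #|C' :\: C| => a b c; clear; lia.
Qed.

(** A matching with the fewest exposed vertices, among those that expose at most
    one vertex of degree three, exposes at most one vertex of degree two as well:
    two of them could be matched along an extra edge. *)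
Lemma near_perfect Q r s0 (h := contracted e Q r) (K := kept Q r s0 :\ r) n0 :
  r \in Q ->
  is_matching (induced h K) n0 ->
  #|[set x in exposed n0 K | degree e x == 3]| <= 1 ->
  exists2 n, is_matching (induced h K) n & #|exposed n K| <= 2.
Proof.
move=> Qr n0M n0c.
pose ok n := is_matching (induced h K) n &&
  (#|[set x in exposed n K | degree e x == 3]| <= 1).
have ok0 : ok n0 by rewrite /ok n0M.
case: (arg_minnP (fun n => #|exposed n K|) ok0) => n /andP[nM nc] nmin.
exists n => //; rewrite leqNgt; apply/negP=> gt2.
have /card_gt1P[x [y []]] : 1 < #|exposed n K :\: [set x | degree e x == 3]|.
  move: gt2; rewrite -(cardsID [set x | degree e x == 3] (exposed n K)).
  have -> : exposed n K :&: [set x | degree e x == 3] =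
            [set x in exposed n K | degree e x == 3] by apply/setP=> z; rewrite !inE.
  by move: #|_| #|_| nc => a b; clear; lia.
case/setDP=> /setIdP[Kx /eqP nx] dx /setDP[/setIdP[Ky /eqP ny] dy] xy.
have notQ z : z \in K -> z \notin Q.
  case/setD1P=> zr; rewrite /kept; case: ifP => _; rewrite !inE (negbTE zr) //=.
  by case/andP.
have hxy : induced h K x y.
  rewrite /induced /h /contracted /= Kx Ky xy !notQ //=; apply/orP; left.
  move: dx dy; rewrite !inE.
  by case: (edeg x) => ->; case: (edeg y) => ->.
have hsym : symmetric (induced h K) by apply/induced_sym/contracted_sym.
have rM := rematch_matching hsym nM hxy xy nx.
have [nK _] := is_matchingP _ _ nM.
have expE : exposed (rematch n x y) K = exposed n K :\ x :\ y.
  by rewrite exposed_rematch // ny eqxx setU0.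
have : #|exposed n K| <= #|exposed (rematch n x y) K|.
  apply: nmin; rewrite /ok rM /=; apply: leq_trans nc.
  apply/subset_leq_card/subsetP=> z; rewrite expE => /setIdP[/setD1P[_ /setD1P[_ ez]] dz].
  by apply/setIdP.
rewrite expE (cardsD1 x (exposed n K)) (cardsD1 y (exposed n K :\ x)).
have -> : x \in exposed n K by apply/setIdP; rewrite nx.
have -> : y \in exposed n K :\ x.
  by apply/setD1P; rewrite eq_sym; split=> //; apply/setIdP; rewrite ny.
by move=> /ltnW; rewrite add1n ltnn.
Qed.

(** All edges of [e] leaving [C] belong to the matching. If one of them ends at
    a vertex of degree two, it is released. Otherwise [C] is contracted together
    with the partners of its vertices, and a perfect matching of the contracted
    graph matches some such partner [u] to a vertex [y] beyond; the new matching
    uses [u y], releases the old edge at [u], keeps the other edges leaving [C]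
    and follows the perfect matching elsewhere. *)
Lemma growing_step m C s0 : growing m C -> degree e s0 = 2 -> s0 \notin C ->
  exists m' C', growing m' C' /\
    C :&: [set x | degree e x == 2] \proper C' :&: [set x | degree e x == 2].
Proof.
move=> gC d0 nCs0; have [[mM C0] _ clC cov _] := gC.
have [mK em] := is_matchingP _ _ mM.
have /set0Pn[c Cc] := C0.
have exit u v : u \in C -> v \notin C -> e u v -> v = m u.
  move=> Cu nCv euv; apply/eqP; apply: contraNT nCv => nv.
  by apply: (clC u Cu); rewrite residualE // euv.
have [w /and3P[Cw nCb /eqP db]|noleaf] :=
    pickP [pred w | [&& w \in C, m w \notin C & degree e (m w) == 2]].
  have bw : m w != w by apply: contraNneq nCb => ->.
  have m'M := unmatch_matching w mM.
  have [|x Cx xw|x nCx d3|C' gC' ltC] := growing_release gC m'M Cw nCb.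
  - by rewrite ffunE eqxx.
  - by rewrite ffunE (negbTE xw); case: eqP => // xb; rewrite -xb Cx in nCb.
  - rewrite ffunE; case: ifP => [/orP[] /eqP xE|_]; last exact: cov.
      by rewrite xE Cw in nCx.
    by rewrite -xE d3 in db.
  by exists (unmatch m w), C'.
have ndeg x : x \notin C -> m x \in C -> degree e x = 3.
  move=> nCx Cmx; have := noleaf (m x); rewrite /= Cmx mK nCx /=.
  by case: (edeg x) => ->.
pose Q := C :|: [set x | m x \in C].
have nQs0 : s0 \notin Q.
  rewrite !inE (negbTE nCs0) /=; apply/negP=> /(ndeg _ nCs0).
  by rewrite d0.
have Qc : c \in Q by rewrite inE Cc.
have Qm x : (m x \in Q) = (x \in Q) by rewrite !inE mK orbC.
have keptE x : x \in kept Q c s0 -> x != c -> x \notin Q.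
  rewrite /kept => + xc.
  by case: ifP => _; rewrite ?in_setD1 in_setU1 (negbTE xc) in_setC //= => /andP[].
have [|p pM freep] :=
  contraction_matching esym eirr econ ebridge edeg Qc nQs0 d0.
  (* m itself, restricted to the vertices outside Q other than s0 and its partner,
     exposes no vertex of degree three but possibly that partner *)
  right; pose skip x := [|| x \in Q, x == s0 | x == m s0].
  have skipm x : skip (m x) = skip x.
    by rewrite /skip Qm (can_eq mK) (inv_eq mK); congr (_ || _); apply: orbC.
  pose n0 : {ffun T -> T} := [ffun x => if skip x then x else m x].
  have nQE x : x \notin Q -> contract Q c x = x by rewrite /contract => /negbTE->.
  have keptI x : x \notin Q -> x != s0 -> x \in kept Q c s0 :\ c.
    move=> nQx xs0; apply/setD1P; split; first by apply: contraNneq nQx => ->.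
    by rewrite -(nQE x nQx) kept_contract.
  apply: (@near_perfect _ _ _ n0) => //.
    apply/is_matchingP; split=> x; rewrite !ffunE.
      by case E: (skip x); rewrite /= ?skipm E.
    case: ifP => [|/norP[nQx /norP[xs0 xms0]]]; first by rewrite eqxx.
    move=> nx; have nQmx : m x \notin Q by rewrite Qm.
    rewrite /induced /= !keptI //; last by rewrite -(mK s0) (can_eq mK).
    rewrite /contracted /= eq_sym nx /=; apply/orP; right.
    by apply/existsP; exists x; apply/existsP; exists (m x); rewrite !nQE // !eqxx em.
  rewrite -[X in _ <= X](cards1 (m s0)); apply/subset_leq_card/subsetP=> x.
  case/setIdP=> /setIdP[/setD1P[xc Kx]]; rewrite ffunE => + /eqP d3.
  have nQx := keptE _ Kx xc; rewrite /skip (negbTE nQx) inE /=.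
  have xs0 : x != s0 by apply: contra_eq_neq d3 => ->; rewrite d0.
  rewrite (negbTE xs0) /=; case: ifP => // _ /eqP mx.
  have nCx : x \notin C by apply: contra nQx => Cx; rewrite inE Cx.
  by have := cov x nCx d3; rewrite mx eqxx.
have [pK gp] := is_matchingP _ _ pM.
have Kc : c \in kept Q c s0.
  have := @kept_contract _ Q c s0 Qc nQs0 c; rewrite /contract Qc; apply.
  by apply: contraNneq nCs0 => <-.
pose y := p c.
have yc : y != c by apply: freep.
have nQy : y \notin Q by have /and3P[_ Ky _] := gp _ yc; apply: keptE.
have contractE u x : x \notin Q -> contract Q c u = x -> u = x.
  by rewrite /contract; case: ifP => // _ + E; rewrite -E Qc.
have [u Qu euy] : exists2 u, u \in Q & e u y.
  have /and3P[_ _ /andP[_]] := gp _ yc; rewrite Qc /=.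
  case/existsP=> u /existsP[v /and3P[/eqP uc /eqP vy euv]]; exists u.
    apply: contraT => nQu; move: uc; rewrite /contract (negbTE nQu) => E.
    by rewrite E Qc in nQu.
  by rewrite -/y -(contractE v y nQy vy).
have nCy : y \notin C by apply: contra nQy => Cy; rewrite inE Cy.
have nCu : u \notin C.
  apply: contra nQy => Cu; rewrite (exit u y Cu nCy euy) Qm //.
have Cmu : m u \in C by move: Qu; rewrite !inE (negbTE nCu).
(* m1 follows m on Q and p elsewhere, forgetting the extra edges and the edge of
   p at the contracted vertex; y is thereby exposed, ready to be matched to u *)
pose m1 : {ffun T -> T} := [ffun x => if x \in Q then m x else
  if (p x \notin Q) && e x (p x) then p x else x].
have m1M : is_matching e m1.
  apply/is_matchingP; split=> x; rewrite !ffunE; case Qx: (x \in Q) => /=.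
  - by rewrite Qm Qx; apply: mK.
  - case E: (_ && _) => /=; last by rewrite Qx E.
    by have /andP[/negbTE-> exp] := E; rewrite pK Qx esym exp.
  - exact: em.
  - by case: ifP => [/andP[]|_]; last rewrite eqxx.
have m1y : m1 y = y by rewrite ffunE (negbTE nQy) /y pK Qc.
have m1u : m1 u = m u by rewrite ffunE Qu.
have uy : u != y by apply: contraTneq Qu => ->.
have yu : y != u by rewrite eq_sym.
have eyu : e y u by rewrite esym.
have m'M := rematch_matching esym m1M eyu yu m1y.
have muy : m u != y by apply: contraNneq nCy => <-.
have muu : m u != u by apply: contraNneq nCu => <-.
have [||x Cx xw|x nCx d3|C' gC' ltC] := @growing_release _ _ _ (m u) gC m'M Cmu.
- by rewrite mK.
- by rewrite ffunE (negbTE muy) (negbTE muu) m1u eqxx.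
- have xy : x != y by apply: contraNneq nCy => <-.
  have xu : x != u by apply: contraNneq nCu => <-.
  by rewrite ffunE (negbTE xy) (negbTE xu) m1u (negbTE xw) ffunE inE Cx.
- rewrite ffunE; have [->//|xy] := eqVneq x y.
  have [->//|xu] := eqVneq x u.
  have xmu : x != m u by apply: contraNneq nCx => ->.
  rewrite m1u (negbTE xmu) ffunE; case: ifP => [Qx|/negbT nQx]; first exact: cov.
  have xs0 : x != s0 by apply: contra_eq_neq d3 => ->; rewrite d0.
  have Kx : x \in kept Q c s0.
    by have := kept_contract Qc nQs0 xs0; rewrite /contract (negbTE nQx).
  have nx := freep _ Kx; have /and3P[_ Kpx /andP[_]] := gp _ nx.
  rewrite d3 /= andbF /=.
  case/existsP=> a /existsP[b /and3P[/eqP ax /eqP bpx eab]].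
  have nQpx : p x \notin Q.
    apply: keptE => //; apply: contra_neq xy => pxc.
    by rewrite /y -pxc pK.
  rewrite (contractE a x nQx ax) (contractE b (p x) nQpx bpx) in eab.
  by rewrite nQpx eab.
by exists (rematch m1 y u), C'.
Qed.

Lemma growing_spanning s1 s0 : s1 != s0 -> degree e s1 = 2 -> degree e s0 = 2 ->
  exists m C, growing m C /\ [set x | degree e x == 2] \subset C.
Proof.
move=> s10 d1 d0; have [m0 [C0 g0]] := growing_start s10 d1 d0.
set S := [set x | degree e x == 2].
move: {2}(#|S| - #|C0 :&: S|) (leqnn (#|S| - #|C0 :&: S|)) => k.
elim: k m0 C0 g0 => [|k IH] m C gC.
all: have [sSC|] := boolP (S \subset C); first by exists m, C.
all: case/subsetPn=> s /[!inE] /eqP ds nCs.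
all: have [m' [C' [gC' ltC]]] := growing_step gC ds nCs.
all: have := proper_card ltC; have := subset_leq_card (subsetIr C' S).
  by rewrite -/S; move: #|S| #|_ :&: S| #|_ :&: S| => a b c; clear; lia.
move=> le1 le2 lek; apply: (IH m' C' gC').
by move: le1 le2 lek; rewrite -/S; move: #|S| #|_ :&: S| #|_ :&: S| => a b c; clear; lia.
Qed.

Lemma matching_of_involution m : is_matching e m -> matching e (matching_edges m).
Proof.
move=> /is_matchingP[mK em]; split.
  apply/subsetP=> E /imsetP[x]; rewrite inE => nx ->; rewrite inE.
  by apply/existsP; exists x; apply/existsP; exists (m x); rewrite em // eqxx.
apply/trivIsetP=> A B /imsetP[x _ ->] /imsetP[y _ ->]; apply: contraR.
rewrite -setI_eq0 => /set0Pn[z]; rewrite !inE => /andP[].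
by case/orP=> /eqP-> /orP[] /eqP; rewrite ?[in RHS]setUC => E;
  [rewrite E | rewrite E mK setUC | rewrite -E mK setUC | rewrite (inv_inj mK E)].
Qed.

Lemma card_matching_edges m : is_matching e m ->
  2 * #|matching_edges m| = #|[set x | m x != x]|.
Proof.
move=> mM; have [_ /eqP tiM] := matching_of_involution mM.
have -> : [set x | m x != x] = cover (matching_edges m).
  have [mK _] := is_matchingP _ _ mM.
  apply/setP=> x; apply/idP/bigcupP => [nx | [E /imsetP[y ny ->]]].
    by exists [set x; m x]; [apply: imset_f | rewrite !inE eqxx].
  rewrite !inE in ny *; case/orP=> /eqP-> //.
  by rewrite mK eq_sym.
rewrite -tiM mulnC -sum_nat_const; apply: eq_bigr => E /imsetP[x].
by rewrite inE eq_sym => nx ->; rewrite cards2 nx.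
Qed.

(** Degree count: the residual degrees sum to [2 * #|T| - 2], those of [e] to
    [3 * #|T|] minus the number of degree-two vertices, and they differ by the
    number of matched vertices. *)
Lemma growing_card m C : growing m C -> [set x | degree e x == 2] \subset C ->
  2 * #|matching_edges m| + #|[set x | degree e x == 2]| = #|T| + 2.
Proof.
move=> [[mM C0] _ clC cov treeC] /subsetP sSC.
set S := [set x | _] in sSC *.
rewrite card_matching_edges //.
have sumF : \sum_x degree (residual m) x + 2 = 2 * #|T|.
  rewrite (bigID [in C]) /= sum_degree_closed // addnAC treeC.
  rewrite (eq_bigr (fun=> 2)) => [|x nCx]; last first.
    case: (edeg x) => dx; last exact: degree_residual3 (cov x nCx dx).
    by rewrite sSC ?inE ?dx in nCx.
  rewrite sum_nat_const -(cardC C) mulnDr; congr (_ + _); rewrite mulnC.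
  by congr (_ * _); apply: eq_card.
have sumE : \sum_x degree e x + #|S| = 3 * #|T|.
  rewrite -sum1_card [X in _ + X](big_mkcond) -big_split /= mulnC -sum_nat_const.
  by apply: eq_bigr => x _; rewrite inE; case: (edeg x) => ->.
have : \sum_x degree e x = \sum_x degree (residual m) x + #|[set x | m x != x]|.
  rewrite -sum1_card [X in _ + X](big_mkcond) -big_split /=.
  by apply: eq_bigr => x _; rewrite inE -(degree_residual x mM); case: (m x != x).
move: sumF sumE; move: (\sum_x _) (\sum_x _) #|T| #|S| #|[set x | m x != x]|.
by clear; lia.
Qed.

Lemma growing_tree_and_cycles m C : growing m C ->
  [set x | degree e x == 2] \subset C ->
  tree_and_cycles (residual m) [set x | degree e x == 2].
Proof.
move=> [[mM C0] conC clC cov cardC] sSC; have /set0Pn[c Cc] := C0.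
have fsym := residual_sym m; have firr := residual_irr m.
have fcs : connect_sym (residual m) by apply: sym_connect_sym.
have CE x : (x \in C) = connect (residual m) c x.
  apply/idP/idP => [Cx | cx].
    apply: (connect_sub _ (conC _ _ Cc Cx)) => u v /and3P[_ _].
    exact: connect1.
  apply: contraT => nCx; have [u [v [Cu nCv fuv]]] := connect_escape cx Cc nCx.
  by rewrite (clC u Cu v fuv) in nCv.
exists C; split=> //.
- apply/imsetP; exists c => //; apply/setP=> x.
  by rewrite CE !inE.
- exact: tree_of_card Cc conC cardC.
move=> D /imsetP[x _ ->] neD.
have DE y : (y \in [set y in [set: T] | connect (residual m) x y]) =
  connect (residual m) x y by rewrite !inE.
have nCD y : connect (residual m) x y -> y \notin C.
  move=> xy; apply: contra neD; rewrite CE => cy; apply/eqP/setP=> z.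
  rewrite DE CE; have cx : connect (residual m) c x.
    by apply: connect_trans cy _; rewrite fcs.
  by rewrite (same_connect fcs cx).
apply: (@cycle_of_degree2 _ _ fsym firr _ x).
- by rewrite DE.
- by move=> y; rewrite DE => xy z yz; rewrite DE (connect_trans xy) ?connect1.
- by move=> y; rewrite DE.
move=> y; rewrite DE => /nCD nCy.
case: (edeg y) => dy; last exact: degree_residual3 (cov y nCy dy).
by rewrite (subsetP sSC) ?inE ?dy in nCy.
Qed.

End Growth.

Theorem theorem1p3 (T : finType) (e : rel T) (S : {set T}) (k : nat)
    (He : simple_graph e)
    (Hconn : connected e)
    (Hbridgeless : bridgeless e)
    (Hdeg : forall x : T, degree e x = 2 \/ degree e x = 3)
    (HS : S = [set x | degree e x == 2])
    (HSk : #|S| = k)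
    (Hk : 2 <= k) :
  exists M : {set {set T}},
    [/\ matching e M,
        (#|M|%:R = (#|T|%:R - k%:R + 2%:R) / 2%:R :> rat)%R &
        tree_and_cycles (del_edges e M) S].
Proof.
have [esym eirr] := He.
move: Hk; rewrite -{}HSk {S}HS => /card_gt1P[s1 [s0 []]].
rewrite !inE => /eqP d1 /eqP d0 s10.
have [m [C [gC sSC]]] :=
  growing_spanning esym eirr Hconn Hbridgeless Hdeg s10 d1 d0.
have [[mM _] _ _ _ _] := gC.
exists (matching_edges m); split.
- exact: matching_of_involution.
- have E : ((2 * #|matching_edges m| + #|[set x | degree e x == 2]|)%:R =
            (#|T| + 2)%:R :> rat)%R by rewrite (growing_card eirr Hdeg gC sSC).
  rewrite GRing.natrD GRing.natrM [RHS]GRing.natrD in E.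
  apply: (canRL (GRing.mulfK _)) => //.
  by rewrite GRing.addrAC -E GRing.addrK GRing.mulrC.
- exact: (growing_tree_and_cycles esym eirr Hdeg gC sSC).
Qed.
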